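(* Let $\varphi$ be a real-valued Riemann integrable function on $\mathbb{T}$ such that $\mu\{x\in\mathbb{T}\colon\varphi(x)\ne c\}>0$ for any $c\in\mathbb{R}$. (1) There exist $\lambda=\lambda(\varphi)>1$ and $c(\varphi)>0$ such that for any $N\in\mathbb N$ and any $\lambda$-lacunary sequence $k_1,\ldots,k_N$ we have $$ d_n^{\mathrm{avg}}(\{\varphi(k_1x),\ldots,\varphi(k_Nx)\},L_0(\mathbb{T}))\ge c(\varphi)\quad\text{if } n\le c(\varphi)N. $$ (2) For any $\varepsilon>0$ there exist $\lambda=\lambda(\varphi,\varepsilon)>1$ and $c(\varphi,\varepsilon)>0$ such that for any $N\in\mathbb N$ and any $\lambda$-lacunary sequence $k_1,\ldots,k_N$ we have $$ d_n^{\mathrm{avg}}(\{\varphi(k_1x),\ldots,\varphi(k_Nx)\},L_1(\mathbb{T}))\ge c(\varphi,\varepsilon)\quad\text{if } n\le N(1-\varepsilon). $$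
   Context: $\mathbb{T}=\mathbb{R}/\mathbb{Z}$ with Lebesgue measure $\mu$; functions on $\mathbb{T}$ are $1$-periodic functions. For $\lambda>1$, a sequence of positive integers $k_1,\ldots,k_N$ is $\lambda$-lacunary if $k_{j+1}/k_j\ge\lambda$ for $j=1,\ldots,N-1$. $L_0(\mathbb{T})$ is the space of measurable functions with $\|f\|_{L_0}=\sup\{t\ge 0\colon\mu\{x\colon|f(x)|\ge t\}\ge t\}$ and distance $\|f-g\|_{L_0}$. For $X=L_0(\mathbb T)$ or $X=L_1(\mathbb T)$, $d_n^{\mathrm{avg}}(\{x_1,\ldots,x_N\},X)=\inf_{Q_n}\frac1N\sum_{i=1}^N\inf_{y\in Q_n}\|x_i-y\|_X$, the infimum being over linear subspaces $Q_n\subset X$ of dimension at most $n$. *)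

(* Defs.v *)
From HB Require Import structures.
From mathcomp Require Import all_boot all_order all_algebra.
From mathcomp Require Import all_classical all_reals all_analysis.

Set Implicit Arguments.
Unset Strict Implicit.
Unset Printing Implicit Defensive.

Import Order.TTheory GRing.Theory Num.Theory.
Import numFieldNormedType.Exports.

Local Open Scope classical_set_scope.
Local Open Scope ring_scope.

Section riemann.
Context {R : realType}.
Implicit Types (f : R -> R) (a b : R) (s : seq R) (t : nat -> R).

(* The subdivision a = x_0 < ... < x_m = b is encoded, as in [itv_partition],
   by s = [:: x_1; ...; x_m], so that x_i is [nth a (a :: s) i]; the tag of the
   cell [x_i, x_{i+1}] is [t i]. *)
Definition tagged_partition a b s t : Prop :=
  itv_partition a b s /\
  forall i, (i < size s)%N -> nth a (a :: s) i <= t i <= nth a (a :: s) i.+1.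

Definition finer_than a s (delta : R) : Prop :=
  forall i, (i < size s)%N ->
    nth a (a :: s) i.+1 - nth a (a :: s) i < delta.

Definition riemann_sum f a s t : R :=
  \sum_(i < size s) f (t i) * (nth a (a :: s) i.+1 - nth a (a :: s) i).

Definition riemann_integrable f a b : Prop :=
  exists I : R, forall e : R, 0 < e -> exists2 delta : R, 0 < delta &
    forall s t, tagged_partition a b s t -> finer_than a s delta ->
      `|riemann_sum f a s t - I| < e.

End riemann.

(* Functions on the circle R/Z are represented by 1-periodic functions on R,
   and the circle itself by its fundamental domain [0, 1[. *)
Section circle.
Context {R : realType}.

(* R with the sigma-algebra of Lebesgue (not only Borel) measurable sets: a
   Riemann integrable function need not be Borel. *)
Local Notation lebesgueR := (caratheodory_type ((wlength (@idfun R))^*)%mu).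

Definition lebesgue : {measure set lebesgueR -> \bar R} :=
  @completed_lebesgue_measure R.

Definition fundamental_domain : set lebesgueR := `[0 : R, 1 : R[%classic.

Definition circle_measure (A : set R) : \bar R :=
  lebesgue ((A : set lebesgueR) `&` fundamental_domain).

Definition L0 : set (R -> R) :=
  [set f | periodic f 1 /\ measurable_fun [set: lebesgueR] (f : lebesgueR -> R)].

Definition L0norm (f : R -> R) : \bar R :=
  ereal_sup [set t%:E | t in
    [set t : R | 0 <= t /\ (t%:E <= circle_measure [set x | (t <= `|f x|)%R])%E]].

Definition L1 : set (R -> R) :=
  [set f | L0 f /\ lebesgue.-integrable fundamental_domain (EFin \o f)].

Definition L1norm (f : R -> R) : \bar R :=
  (\int[lebesgue]_(x in fundamental_domain) `|f x|%:E)%E.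

End circle.

Section kolmogorov.
Context {R : realType}.
Implicit Types (X Q : set (R -> R)) (nrm : (R -> R) -> \bar R).

Definition lin_span n (g : 'I_n -> R -> R) : set (R -> R) :=
  [set (fun x => \sum_(i < n) a i * g i x) | a in [set: 'I_n -> R]].

(* The g i may be linearly dependent, whence "at most". Functions are not
   identified almost everywhere: a subspace of classes of dimension at most n
   is the image of the span of n representatives, and conversely. *)
Definition subspace_dim_le X n Q : Prop :=
  Q `<=` X /\ exists g : 'I_n -> R -> R, Q = lin_span g.

Definition dist_to nrm (f : R -> R) Q : \bar R :=
  ereal_inf [set nrm (f \- y) | y in Q].

Definition avg_width X nrm n N (x : 'I_N -> R -> R) : \bar R :=
  ereal_inf [set (N%:R^-1%:E * \sum_(i < N) dist_to nrm (x i) Q)%E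
            | Q in [set Q | subspace_dim_le X n Q]].

End kolmogorov.

Definition lacunary {R : realType} (lambda : R) N (k : 'I_N -> nat) : Prop :=
  (forall i, (0 < k i)%N) /\
  forall i j : 'I_N, j = i.+1 :> nat -> lambda <= (k j)%:R / (k i)%:R.

Definition dilates {R : realType} (phi : R -> R) N (k : 'I_N -> nat) :
    'I_N -> R -> R :=
  fun i x => phi ((k i)%:R * x).

(* Main.v *)
Require Import Defs.
From mathcomp Require Import all_boot all_order all_algebra.
From mathcomp Require Import all_classical all_reals all_analysis.
From mathcomp Require Import measurable_realfun ring lra zify.

Import Order.TTheory GRing.Theory Num.Theory.
Local Open Scope ring_scope.

Set Implicit Arguments.
Unset Strict Implicit.
Unset Printing Implicit Defensive.

(** A Riemann integrable function that is not almost everywhere constant takes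
    separated values on two whole cells of some uniform partition of the
    circle, and on a fine uniform partition it is almost constant on most cells
    ([separated_cells], [few_nonflat_cells]).  Record, for a point x, the
    pattern formed by the cells that contain k_1 x, ..., k_N x modulo 1.  For a
    lacunary sequence of large ratio lambda, the distribution of the pattern is
    at most (1 + 2 K / lambda)^N times the uniform distribution on the K^N
    patterns ([lebesgue_pattern]).  So the dilates of phi behave like
    independent random variables as far as exponentially small probabilities
    are concerned: an event that is exponentially rare for independent cells
    remains exponentially rare on the circle, once lambda is large.

    The rare event is that the vector xi = (phi (k_i x))_i comes close to a
    fixed subspace V of R^N of dimension at most (1 - eps) N, outside a set B of
    few coordinates.  Let W be the space of the vectors that are orthogonal to V
    and vanish on B.  It has dimension proportional to N, hence the orthogonal
    projection on W has large trace and some diagonal entry of it is bounded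
    below: W contains a vector w with w_j = 1 and bounded norm.  Replacing W by
    the subspace where the coordinate j vanishes and iterating gives
    proportionally many pairwise orthogonal vectors w^1, w^2, ... of bounded
    norm, each with pivot 1 at a coordinate where the later ones vanish
    ([large_pivot], [small_ball_system]).  By Bessel's inequality the sum of the
    <w^r, xi>^2 is small when xi is close to V off B.  On the other hand, once
    the other coordinates are chosen, the coordinate at the pivot makes
    exp (- <w^r, xi>^2) smaller than a constant theta < 1 on average, because phi
    is not constant; summing over the pivots one after the other bounds the mean
    of exp (- sum_r <w^r, xi>^2) by a power of theta, and Markov's inequality
    concludes.  The union over B costs only a factor exp (small N)
    ([card_near_off_union]).

    If fewer than a small proportion of the dilates stayed far, in measure, from
    a subspace Q of dimension n <= (1 - eps) N, then for most x the values at x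
    of the approximants, which form a vector of the column space of an N x n
    matrix, would agree with xi up to a small error and few coordinates; this is
    the rare event ([many_far_indices]).  A dilate that is far from Q in measure
    is far from Q both for the L_0 distance and for the L_1 distance, so that
    both parts of the theorem follow, the first one with eps = 1/2. *)

(** * Orthogonal systems with large pivots *)

Definition dot {R : realFieldType} {N : nat} (u v : 'rV[R]_N) : R :=
  \sum_i u 0 i * v 0 i.

Section dot_theory.
Context {R : realFieldType} {N : nat}.
Implicit Types u v w : 'rV[R]_N.

Lemma dotE u v : dot u v = (u *m v^T) 0 0.
Proof. by rewrite mxE; apply: eq_bigr => i _; rewrite mxE. Qed.

Lemma dotC u v : dot u v = dot v u.
Proof. by apply: eq_bigr => i _; rewrite mulrC. Qed.

Lemma dotDr u v w : dot u (v + w) = dot u v + dot u w.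
Proof. by rewrite -big_split; apply: eq_bigr => i _; rewrite mxE mulrDr. Qed.

Lemma dotZr a u v : dot u (a *: v) = a * dot u v.
Proof. by rewrite mulr_sumr; apply: eq_bigr => i _; rewrite mxE mulrCA. Qed.

Lemma dotDl u v w : dot (u + v) w = dot u w + dot v w.
Proof. by rewrite !(dotC _ w) dotDr. Qed.

Lemma dotZl a u v : dot (a *: u) v = a * dot u v.
Proof. by rewrite !(dotC _ v) dotZr. Qed.

Lemma dot_ge0 u : 0 <= dot u u.
Proof. by apply: sumr_ge0 => i _; rewrite -expr2 sqr_ge0. Qed.

Lemma dot_eq0 u : (dot u u == 0) = (u == 0).
Proof.
apply/idP/eqP => [|->]; last by rewrite /dot big1 // => i _; rewrite mxE mul0r.
rewrite /dot psumr_eq0; last by move=> i _; rewrite -expr2 sqr_ge0.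
move/allP => h; apply/rowP => i; rewrite mxE; apply/eqP.
by have := h i (mem_index_enum _); rewrite mulf_eq0 orbb.
Qed.

End dot_theory.

(** A vector x in the kernel of the Gram matrix satisfies |x M|^2 = 0. *)
Lemma gram_unitmx (R : realFieldType) m N (M : 'M[R]_(m, N)) :
  row_free M -> M *m M^T \in unitmx.
Proof.
move=> freeM; rewrite -row_free_unit -kermx_eq0; apply/rowV0P => x.
move/sub_kermxP => xG0; apply: (row_free_inj freeM); rewrite mul0mx.
apply/eqP; rewrite -dot_eq0 dotE trmx_mul mulmxA -(mulmxA x) xG0 mul0mx.
by rewrite mxE.
Qed.

(** Let P be the orthogonal projection on the left kernel of A.  Its trace is the
    dimension of the kernel, at least N - n, so some diagonal entry P j j is at
    least (N - n) / N; the vector w is the row j of P divided by P j j.  A kernel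
    vector v satisfies v = v P, so <v, w> is v_j divided by P j j: this is the
    orthogonality in the conclusion. *)
Lemma large_pivot (R : realFieldType) n N (A : 'M[R]_(N, n)) : (n < N)%N ->
  exists j, exists w : 'rV[R]_N,
    [/\ w *m A = 0, w 0 j = 1, dot w w <= N%:R / (N - n)%:R &
        forall v : 'rV_N, v *m A = 0 -> v 0 j = 0 -> dot v w = 0].
Proof.
move=> ltnN; have [r [M [freeM eqM rE]]] :
    exists r, exists M : 'M[R]_(r, N),
    [/\ row_free M, (M :=: kermx A)%MS & r = \rank (kermx A)].
  exists _, (row_base (kermx A)).
  by split; [exact: row_base_free | exact: eq_row_base |].
pose G := M *m M^T; have uG : G \in unitmx by apply: gram_unitmx.
pose P := M^T *m invmx G *m M.
have PA : P *m A = 0.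
  rewrite -mulmxA; apply/eqP; rewrite (_ : M *m A = 0) ?mulmx0 //.
  by apply/sub_kermxP; rewrite eqM.
have vP (v : 'rV_N) : v *m A = 0 -> v *m P = v.
  move/sub_kermxP => vA; have /submxP[x ->] : (v <= M)%MS by rewrite eqM.
  by rewrite /P !mulmxA -(mulmxA x M) mulmxK.
have trP : P^T = P.
  rewrite /P !trmx_mul trmxK mulmxA trmx_inv; congr (_ *m invmx _ *m _).
  by rewrite /G trmx_mul trmxK.
have PP : P *m P = P.
  by apply/row_matrixP => i; rewrite row_mul vP // -row_mul PA row0.
have le_rk : (N - n <= r)%N by rewrite rE mxrank_ker leq_sub2l ?rank_leq_col.
have trace_P : \tr P = r%:R.
  by rewrite /P -mulmxA mxtrace_mulC -mulmxA mulVmx // mxtrace1.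
have [j Pj] : exists j, (N - n)%:R / N%:R <= P j j.
  apply/existsP; apply: contraT; rewrite negb_exists => /forallP h.
  suff : \tr P < \sum_(i < N) ((N - n)%:R / N%:R : R).
    rewrite trace_P sumr_const card_ord -[_ *+ N]mulr_natr divfK.
      by rewrite ltr_nat ltnNge le_rk.
    by rewrite pnatr_eq0 -lt0n (leq_ltn_trans _ ltnN).
  apply: ltr_sum => [|i _]; last by rewrite ltNge h.
  by apply/hasP; exists (Ordinal ltnN); rewrite ?mem_index_enum.
have N0 : (0 < N%:R :> R) by rewrite ltr0n (leq_ltn_trans _ ltnN).
have d0 : (0 < (N - n)%:R :> R) by rewrite ltr0n subn_gt0.
have Pj0 : 0 < P j j by apply: lt_le_trans Pj; rewrite divr_gt0.
exists j, ((P j j)^-1 *: row j P); split.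
- by rewrite -scalemxAl -row_mul PA row0 scaler0.
- by rewrite mxE [row _ _ _ _]mxE mulVf ?gt_eqF.
- rewrite dotZl dotZr (_ : dot _ _ = P j j); last first.
    by rewrite dotE tr_row trP -row_mul colE mulmxA PP -colE mxE [col _ _ _ _]mxE.
  rewrite mulVf ?gt_eqF // mulr1 -(invf_div (N - n)%:R).
  by rewrite lef_pV2 // posrE divr_gt0.
- move=> v vA vj; rewrite dotZr (_ : dot _ _ = v 0 j) ?vj ?mulr0 //.
  by rewrite dotE tr_row trP colE mulmxA vP // -colE mxE.
Qed.

Definition upd {N : nat} {T : finType} (s : {ffun 'I_N -> T}) (j : 'I_N) (a : T) :
  {ffun 'I_N -> T} := [ffun i => if i == j then a else s i].

(** Overwriting the coordinate j by a while remembering the old value is an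
    involution on the pairs (s, a). *)
Lemma resample_sum (R : realFieldType) N (T : finType) (j : 'I_N)
    (F : {ffun 'I_N -> T} -> R) :
  \sum_s \sum_a F (upd s j a) = #|T|%:R * \sum_s F s.
Proof.
pose h (p : {ffun 'I_N -> T} * T) := (upd p.1 j p.2, p.1 j).
have hK : involutive h.
  case=> s a; rewrite /h /upd /= ffunE eqxx; congr pair.
  by apply/ffunP => i; rewrite !ffunE; case: eqP => // ->.
rewrite pair_big /= (reindex_inj (inv_inj hK)) /=.
rewrite (eq_bigr (fun p : {ffun 'I_N -> T} * T => F p.1)); last first.
  by move=> p _; have /(congr1 fst) /= := hK p => ->.
rewrite -(pair_big xpredT xpredT (fun s (_ : T) => F s)) /= mulr_sumr.
by apply: eq_bigr => s _; rewrite sumr_const mulr_natl.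
Qed.

Definition values {R : realType} {N : nat} {T : finType} (c : T -> R)
  (s : {ffun 'I_N -> T}) : 'rV[R]_N := \row_i c (s i).

Lemma dot_upd (R : realType) N (T : finType) (c : T -> R) (w : 'rV[R]_N) s j a :
  dot w (values c (upd s j a)) =
  w 0 j * c a + \sum_(i | i != j) w 0 i * c (s i).
Proof.
rewrite /dot (bigD1 j) //= !mxE ffunE eqxx; congr (_ + _).
by apply: eq_bigr => i /negPf ij; rewrite mxE ffunE ij.
Qed.

(** The hypothesis on theta says that a single coordinate, uniformly distributed in
    T, is spread out: no translate of it is concentrated near 0.  The system ws is
    built by adding pivots one by one; each pivot vector lies in the kernel of A
    enlarged by the columns of the previous pivots, which makes the system orthogonal
    (whence the Bessel inequality with constant C, a bound for the squared norms) and
    makes the later factors independent of the earlier pivot coordinates (whence one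
    factor theta for each pivot). *)
Lemma small_ball_system (R : realType) N (T : finType) (c : T -> R) (theta : R) :
  0 <= theta ->
  (forall l, \sum_a expR (- (c a - l) ^+ 2) <= #|T|%:R * theta) ->
  forall k n (A : 'M[R]_(N, n)) (C : R), (n + k <= N)%N ->
  N%:R / (N - n - k).+1%:R <= C ->
  exists ws : seq 'rV[R]_N,
  [/\ forall w, w \in ws -> w *m A = 0,
      forall u, \sum_(w <- ws) dot w u ^+ 2 <= C * dot u u &
      \sum_s expR (- \sum_(w <- ws) dot w (values c s) ^+ 2) <=
        theta ^+ k * #|{ffun 'I_N -> T}|%:R].
Proof.
move=> theta0 htheta; elim=> [|k IH] n A C le_nk le_C.
  exists [::]; split => //.
  - move=> u; rewrite big_nil mulr_ge0 ?dot_ge0 //.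
    by apply: le_trans le_C; rewrite divr_ge0.
  - under eq_bigr do rewrite big_nil oppr0 expR0.
    by rewrite expr0 mul1r sumr_const.
have ltnN : (n < N)%N by lia.
have [j [w [wA wj w_le w_orth]]] := large_pivot A ltnN.
have [||ws [wsA wsC ws_sum]] := IH _ (row_mx A (delta_mx j 0 : 'cV_N)) C; [lia| |].
  by rewrite (_ : N - (n + 1) - k = N - n - k.+1)%N //; lia.
have {}wsA v : v \in ws -> v *m A = 0 /\ v 0 j = 0.
  move/wsA => vA0; have /eq_row_mx[vA vj] :
      row_mx (v *m A) (v *m (delta_mx j 0 : 'cV_N)) = row_mx 0 0.
    by rewrite -mul_mx_row vA0 row_mx0.
  split=> //; have /rowP/(_ 0) := vj.
  by rewrite -colE !mxE.
exists (w :: ws); split.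
- by move=> v; rewrite inE => /predU1P[->//|/wsA[]].
- move=> u; rewrite big_cons.
  have w0 : 0 < dot w w.
    rewrite lt_neqAle dot_ge0 eq_sym dot_eq0 andbT.
    by apply/eqP => w0; move: wj; rewrite w0 mxE => /esym/eqP; rewrite oner_eq0.
  pose t := dot w u / dot w w; pose u' := u + (- t) *: w.
  have -> : \sum_(v <- ws) dot v u ^+ 2 = \sum_(v <- ws) dot v u' ^+ 2.
    apply: eq_big_seq => v /wsA[vA vj].
    by rewrite /u' dotDr dotZr (w_orth v) // mulr0 addr0.
  apply: le_trans (lerD (lexx _) (wsC u')) _.
  have -> : dot u' u' = dot u u - dot w u ^+ 2 / dot w w.
    rewrite /u' dotDr !dotDl !dotZr !dotZl (dotC u w) /t; field.
    by rewrite gt_eqF.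
  have wC : dot w w <= C.
    apply: le_trans w_le (le_trans _ le_C).
    rewrite ler_wpM2l // lef_pV2 ?posrE ?ltr0n ?subn_gt0 // ler_nat; lia.
  rewrite mulrBr addrC -lerBrDr lerD2l lerN2 mulrCA ler_peMr ?sqr_ge0 //.
  by rewrite ler_pdivlMr // mul1r.
- have [T0|T0] := posnP #|T|.
    rewrite big1 ?mulr_ge0 ?exprn_ge0 // => s _.
    by have := card0_eq T0 (s j); rewrite inE.
  have T0' : 0 < #|T|%:R :> R by rewrite ltr0n.
  rewrite -(ler_pM2l T0') -(@resample_sum _ _ _ j) exprS.
  apply: le_trans (_ : #|T|%:R * theta *
      (\sum_s expR (- \sum_(v <- ws) dot v (values c s) ^+ 2)) <= _); last first.
    by rewrite -!mulrA ler_pM2l // ler_wpM2l.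
  rewrite mulr_sumr; apply: ler_sum => s _.
  pose l := - \sum_(i | i != j) w 0 i * c (s i).
  apply: le_trans (ler_wpM2r (expR_ge0 _) (htheta l)).
  rewrite mulr_suml; apply: ler_sum => a _.
  rewrite big_cons opprD expRD dot_upd wj mul1r /l opprK.
  rewrite le_eqVlt; apply/orP; left; apply/eqP; congr (_ * expR (- _)).
  apply: eq_big_seq => v /wsA[_ vj].
  rewrite dot_upd vj mul0r add0r; congr (_ ^+ 2).
  by rewrite /dot [RHS](bigD1 j) //= vj mul0r add0r; apply: eq_bigr => i _; rewrite mxE.
Qed.

(** * Counting the patterns close to a subspace *)

Definition near_off {R : realType} {N n : nat} {T : finType} (c : T -> R)
    (A : 'M[R]_(N, n)) (t : R) (B : {set 'I_N}) (s : {ffun 'I_N -> T}) : Prop :=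
  exists v : 'cV[R]_n, forall i, i \notin B -> `|c (s i) - (A *m v) i 0| <= t.

(** The columns of EB are added to A so that the system of vectors vanishes on B.
    If s is counted, then on these vectors values c s agrees with a vector u whose
    entries are bounded by t, and the exponential weight of s in small_ball_system is
    at least exp (- C t^2 N): Markov's inequality applies. *)
Lemma card_near_off (R : realType) N (T : finType) (c : T -> R) (theta : R) :
  0 <= theta ->
  (forall l, \sum_a expR (- (c a - l) ^+ 2) <= #|T|%:R * theta) ->
  forall n (A : 'M[R]_(N, n)) (B : {set 'I_N}) k (C t : R),
  (n + #|B| + k <= N)%N -> N%:R / (N - n - #|B| - k).+1%:R <= C -> 0 <= t ->
  #|[set s : {ffun 'I_N -> T} | `[< near_off c A t B s >]]|%:R <=
    expR (C * t ^+ 2 * N%:R) * theta ^+ k * #|{ffun 'I_N -> T}|%:R.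
Proof.
move=> theta0 htheta n A B k C t le_nBk le_C t0.
pose EB : 'M[R]_(N, #|B|) := \matrix_(i, l) (i == enum_val l)%:R.
have [||ws [wsA wsC ws_sum]] :=
  @small_ball_system R N T c theta theta0 htheta k _ (row_mx A EB) C.
- by [].
- by rewrite subnDA.
have C0 : 0 <= C by apply: le_trans le_C; rewrite divr_ge0.
have {}wsA w : w \in ws -> w *m A = 0 /\ forall i, i \in B -> w 0 i = 0.
  move/wsA => w0; have /eq_row_mx[wA wE] : row_mx (w *m A) (w *m EB) = row_mx 0 0.
    by rewrite -mul_mx_row w0 row_mx0.
  split=> // i iB; have /rowP/(_ (enum_rank_in iB i)) := wE.
  rewrite !mxE (bigD1 i) //= mxE enum_rankK_in // eqxx mulr1 big1 ?addr0 //.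
  by move=> j /negPf ji; rewrite mxE enum_rankK_in // ji mulr0.
rewrite -mulrA -ler_pdivrMl ?expR_gt0 // -expRN.
apply: le_trans ws_sum; rewrite mulrC -sum1_card natr_sum mulr_suml.
rewrite [leRHS](bigID [pred s | s \in [set s | `[< near_off c A t B s >]]]) /=.
rewrite -[leLHS]addr0; apply: lerD; last by apply: sumr_ge0 => s _; exact: expR_ge0.
apply: ler_sum => s; rewrite inE => /asboolP[v hv]; rewrite mul1r ler_expR lerN2.
pose u : 'rV[R]_N := \row_i if i \in B then 0 else c (s i) - (A *m v) i 0.
have dot_u w : w \in ws -> dot w (values c s) = dot w u.
  move=> /wsA[wA wB]; apply/eqP; rewrite -subr_eq0 /dot -sumrB.
  apply/eqP; transitivity ((w *m (A *m v)) 0 0).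
    rewrite mxE; apply: eq_bigr => i _; rewrite [u _ _]mxE [values _ _ _ _]mxE.
    by case: ifPn => [/wB->|_]; rewrite ?mul0r ?subr0 // -mulrBr opprB addrC subrK.
  by rewrite mulmxA wA mul0mx mxE.
rewrite (eq_big_seq (fun w => dot w u ^+ 2)); last by move=> w /dot_u ->.
apply: le_trans (wsC u) _; rewrite -mulrA ler_wpM2l //.
rewrite /dot mulr_natr -[N in _ *+ N]card_ord -sumr_const.
apply: ler_sum => i _; rewrite mxE -expr2.
case: ifPn => [_|/hv h]; first by rewrite expr0n /= sqr_ge0.
by rewrite -real_normK ?num_real // lerXn2r // nnegrE.
Qed.

Lemma sum_card_subsets (R : comPzRingType) N (z : R) :
  \sum_(B : {set 'I_N}) z ^+ #|B| = (1 + z) ^+ N.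
Proof.
rewrite exprDn (partition_big (fun B : {set 'I_N} => inord #|B| : 'I_N.+1) xpredT) //=.
apply: eq_bigr => k _; rewrite expr1n mul1r.
rewrite (eq_bigl (fun B : {set 'I_N} => #|B| == k)); last first.
  move=> B; rewrite -val_eqE /= inordK //.
  by rewrite ltnS -[leqRHS]card_ord max_card.
rewrite (eq_bigr (fun=> z ^+ k)); last by move=> B /eqP ->.
rewrite sumr_const; congr (_ *+ _); have := card_draws 'I_N k.
by rewrite card_ord => <-; apply: eq_card => B; rewrite !inE.
Qed.

(** About half of the available pivots are used, so that enough of them remain for
    the norms to stay bounded until the end. *)
Lemma uphalf_bounds m :
  [/\ (m <= uphalf m * 2)%N, (m <= (m - uphalf m).+1 * 2)%N & (uphalf m <= m)%N].
Proof. by rewrite uphalf_half; have := odd_double_half m; split; lia. Qed.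

(** The total exponent per coordinate is at most -2 gamma: the pivots contribute
    - kappa eps / 4 <= - 5 gamma, the tolerance t contributes gamma, and the choice of
    B contributes h beta + exp (- h) <= 2 gamma. *)
Lemma card_near_off_union (R : realType) N (T : finType) (c : T -> R)
    (kappa eps gamma h beta t : R) :
  (forall l, \sum_a expR (- (c a - l) ^+ 2) <= #|T|%:R * expR (- kappa)) ->
  0 < kappa -> 0 < eps -> 20 * gamma <= kappa * eps ->
  expR (- h) <= gamma -> 0 <= h -> beta <= eps / 2 -> h * beta <= gamma ->
  0 <= t -> 4 * t ^+ 2 <= gamma * eps ->
  forall n (A : 'M[R]_(N, n)), n%:R <= N%:R * (1 - eps) -> (0 < N)%N ->
  #|[set s : {ffun 'I_N -> T} | `[< exists B : {set 'I_N},
        #|B|%:R <= beta * N%:R /\ near_off c A t B s >]]|%:R <=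
    expR (- 2 * gamma * N%:R) * #|{ffun 'I_N -> T}|%:R.
Proof.
move=> hkappa kappa0 eps0 gamma_le hgamma h0 beta_le hbeta t0 ht n A le_n N0.
set E := [set s | _]; have N0' : 0 < N%:R :> R by rewrite ltr0n.
pose NB (B : {set 'I_N}) := [set s : {ffun 'I_N -> T} | `[< near_off c A t B s >]].
have card_NB (B : {set 'I_N}) : #|B|%:R <= beta * N%:R ->
    #|NB B|%:R <= expR (- 4 * gamma * N%:R) * #|{ffun 'I_N -> T}|%:R.
  move=> le_B; pose m := (N - n - #|B|)%N.
  have le_sum : (n + #|B|)%:R <= N%:R * (1 - eps / 2) :> R.
    rewrite natrD; apply: le_trans (lerD le_n le_B) _.
    have : beta * N%:R <= eps / 2 * N%:R by rewrite ler_wpM2r.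
    lra.
  have le_sumN : (n + #|B| <= N)%N.
    rewrite -(ler_nat R); apply: le_trans le_sum _.
    by rewrite ler_piMr ?ltW //; lra.
  have le_m : eps / 2 * N%:R <= m%:R.
    rewrite /m -subnDA natrB //; lra.
  have m0 : (0 < m)%N.
    rewrite -(ltr_nat R); apply: lt_le_trans le_m.
    by rewrite !mulr_gt0 // invr_gt0.
  have le_k : eps / 4 * N%:R <= (uphalf m)%:R.
    have [+ _ _] := uphalf_bounds m.
    rewrite -(ler_nat R) natrM => h1; lra.
  have le_C : N%:R / (m - uphalf m).+1%:R <= 4 / eps.
    have [_ h1 _] := uphalf_bounds m.
    rewrite ler_pdivrMr ?ltr0n // mulrAC ler_pdivlMr //.
    by move: h1; rewrite -(ler_nat R) natrM => h1; lra.
  have := @card_near_off R N T c _ (expR_ge0 _) hkappa n A B (uphalf m) _ t _ le_C t0.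
  move=> /(_ _)/le_trans; apply.
    have [_ _ h1] := uphalf_bounds m.
    by rewrite -leq_subRL // subnDA.
  rewrite ler_wpM2r // -expRM_natr -expRD ler_expR.
  have h1 : kappa * (eps / 4 * N%:R) <= kappa * (uphalf m)%:R.
    by rewrite ler_pM2l.
  have h2 : 4 / eps * t ^+ 2 * N%:R <= gamma * N%:R.
    by rewrite ler_wpM2r // mulrAC ler_pdivrMr.
  have h3 : 20 * gamma * N%:R <= kappa * eps * N%:R by rewrite ler_wpM2r.
  lra.
have E_sub : E \subset \bigcup_(B : {set 'I_N} | #|B|%:R <= beta * N%:R) NB B.
  apply/fintype.subsetP => s; rewrite inE => /asboolP[B [le_B hB]].
  by apply/finset.bigcupP; exists B => //; rewrite inE; apply/asboolP.
apply: le_trans (_ : \sum_(B : {set 'I_N} | #|B|%:R <= beta * N%:R)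
    #|NB B|%:R <= _).
  rewrite -natr_sum ler_nat; apply: leq_trans (subset_leq_card E_sub) _.
  elim/big_rec2: _ => [|B m X _ le_mX]; first by rewrite cards0.
  by apply: leq_trans (leq_card_setU _ _) _; rewrite leq_add2l.
apply: le_trans (ler_sum _ card_NB) _.
rewrite (eq_bigr (fun B : {set 'I_N} => 1 * (expR (- 4 * gamma * N%:R) *
    #|{ffun 'I_N -> T}|%:R))); last by move=> *; rewrite mul1r.
rewrite -mulr_suml mulrA ler_wpM2r //.
have -> : - 2 * gamma * N%:R = 2 * gamma * N%:R + - 4 * gamma * N%:R by ring.
rewrite expRD ler_wpM2r ?expR_ge0 //.
(* Each B of cardinality at most beta N has weight at least 1 here. *)
apply: le_trans (_ : expR (h * beta * N%:R) *
    \sum_(B : {set 'I_N}) expR (- h) ^+ #|B| <= _).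
  rewrite mulr_sumr [leRHS](bigID (fun B : {set 'I_N} => #|B|%:R <= beta * N%:R)) /=.
  rewrite -[leLHS]addr0; apply: lerD.
    apply: ler_sum => B le_B; rewrite -expRM_natr -expRD -[leLHS]expR0 ler_expR.
    have : h * #|B|%:R <= h * (beta * N%:R) by rewrite ler_wpM2l.
    by rewrite mulNr subr_ge0 -mulrA.
  by apply: sumr_ge0 => B _; rewrite mulr_ge0 ?exprn_ge0 ?expR_ge0.
rewrite sum_card_subsets; apply: le_trans (_ : expR (h * beta * N%:R) *
    expR (expR (- h)) ^+ N <= _).
  rewrite ler_wpM2l ?expR_ge0 // lerXn2r ?nnegrE ?addr_ge0 ?expR_ge0 //.
  exact: expR_ge1Dx.
rewrite -expRM_natr -expRD ler_expR -mulrDl ler_wpM2r //; lra.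
Qed.

Local Open Scope classical_set_scope.

(** * The law of the pattern of cells visited by a lacunary sequence *)

Lemma le_lebesgue (R : realType) (A B : set R) :
  A `<=` B -> (lebesgue A <= lebesgue B)%E.
Proof. by move=> AB; exact: (le_outer_measure (wlength (@idfun R))^*%mu _ _ AB). Qed.

Lemma bigsetUP (T : Type) (I : finType) (P : pred I) (F : I -> set T) x :
  (\big[setU/set0]_(i | P i) F i) x <-> exists2 i, P i & F i x.
Proof.
split=> [|[i Pi Fx]]; last by rewrite (bigD1 i) //; left.
by elim/big_rec: _ => // i X Pi IH [Fx|/IH//]; exists i.
Qed.

Lemma lebesgue_subadditive (R : realType) (I : finType) (P : pred I)
    (F : I -> set R) (A : set R) :
  (forall x, A x -> exists2 i, P i & F i x) ->
  (lebesgue A <= \sum_(i | P i) lebesgue (F i))%E.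
Proof.
move=> AF; apply: le_trans (_ : (lebesgue (\big[setU/set0]_(i | P i) F i) <= _)%E).
  by apply: le_lebesgue => x /AF hx; apply/bigsetUP.
elim/big_rec2: _ => [|i m X _ le_mX]; first by rewrite measure0.
apply: le_trans (outer_measureU2 (wlength (@idfun R))^*%mu _ _) _.
exact: leeD.
Qed.

Lemma lebesgue_subadditive_nat (R : realType) n (F : nat -> set R) (A : set R) :
  (forall x, A x -> exists2 i, (i < n)%N & F i x) ->
  (lebesgue A <= \sum_(i < n) lebesgue (F i))%E.
Proof.
move=> AF; apply: (lebesgue_subadditive (F := fun i : 'I_n => F i)) => x.
by move=> /AF[i ltin Fx]; exists (Ordinal ltin).
Qed.

Lemma lebesgue_itv (R : realType) (a b : R) : a <= b ->
  lebesgue (`[a, b[%classic : set R) = (b - a)%:E.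
Proof.
move=> ab; transitivity (@lebesgue_measure R `[a, b[%classic); first by [].
rewrite lebesgue_measure_itv /= lte_fin -EFinB.
by case: ltgtP ab => // -> _; rewrite subrr.
Qed.

(** The cells are understood modulo 1: y belongs to the cell a when its fractional
    part is in [a/K, (a+1)/K[. *)
Definition cell {R : realType} {K : nat} (a : 'I_K) (y : R) : Prop :=
  exists z : int, z%:~R + a%:R / K%:R <= y < z%:~R + a.+1%:R / K%:R.

Lemma cell_ex (R : realType) K (y : R) : (0 < K)%N -> exists a : 'I_K, cell a y.
Proof.
move=> K0; have K0' : 0 < K%:R :> R by rewrite ltr0n.
pose z := Num.floor y; have /andP[zy yz] := floor_itv y.
pose t := (y - z%:~R) * K%:R.
have t0 : 0 <= t by rewrite mulr_ge0 ?subr_ge0 // ltW.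
have /andP[at1 at2] := truncn_itv t0.
have aK : (Num.truncn t < K)%N.
  rewrite -(ltr_nat R); apply: le_lt_trans at1 _.
  rewrite gtr_pMl //; move: yz; rewrite intrD; rewrite -/z; lra.
exists (Ordinal aK); exists z => /=; rewrite -lerBrDl -ltrBlDl.
by rewrite ler_pdivrMr // ltr_pdivlMr // at1.
Qed.

(** One connected component of the set of the x such that k x is in the cell a
    modulo 1. *)
Definition piece {R : realType} (K k : nat) (a : 'I_K) (z : int) : set R :=
  `[(z%:~R + a%:R / K%:R) / k%:R, (z%:~R + a%:R / K%:R) / k%:R + (K * k)%:R^-1[.

Lemma pieceP (R : realType) K k (a : 'I_K) z (x : R) :
  (0 < K)%N -> (0 < k)%N ->
  piece k a z x <-> z%:~R + a%:R / K%:R <= k%:R * x < z%:~R + a.+1%:R / K%:R.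
Proof.
move=> K0 k0; have K0' : 0 < K%:R :> R by rewrite ltr0n.
have k0' : 0 < k%:R :> R by rewrite ltr0n.
rewrite /piece /= in_itv /=.
have -> : (z%:~R + a%:R / K%:R) / k%:R + (K * k)%:R^-1 =
   (z%:~R + a.+1%:R / K%:R) / k%:R :> R.
  by rewrite natrM -natr1; field; rewrite !gt_eqF.
by rewrite ler_pdivrMr // ltr_pdivlMr // (mulrC x).
Qed.

Lemma lebesgue_piece (R : realType) K k (a : 'I_K) z :
  lebesgue (piece k a z : set R) = ((K * k)%:R^-1)%:E.
Proof. by rewrite lebesgue_itv ?lerDl ?invr_ge0 // addrC addKr. Qed.

(** An interval of length l meets at most k l + 2 periods of the map x |-> k x
    modulo 1. *)
Lemma cell_itv_cover (R : realType) K k (a : 'I_K) (al l x : R) :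
  (0 < K)%N -> (0 < k)%N -> al <= x < al + l -> cell a (k%:R * x) ->
  exists2 i, (i < (Num.truncn (1 + k%:R * l)).+1)%N &
    piece k a (Num.floor (k%:R * al) + i%:Z) x.
Proof.
move=> K0 k0 /andP[alx xl] [z /andP[h1 h2]].
have K0' : 0 < K%:R :> R by rewrite ltr0n.
have k0' : 0 < k%:R :> R by rewrite ltr0n.
pose z0 := Num.floor (k%:R * al); rewrite -/z0.
have /andP[z0l lz0] := floor_itv (k%:R * al).
have a1 : a.+1%:R / K%:R <= 1 :> R by rewrite ler_pdivrMr // mul1r ler_nat ltn_ord.
have a0 : 0 <= a%:R / K%:R :> R by rewrite divr_ge0.
have alx' : k%:R * al <= k%:R * x by rewrite ler_wpM2l.
have xl' : k%:R * x < k%:R * al + k%:R * l by rewrite -mulrDr ltr_pM2l.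
have z0z : z0 <= z.
  rewrite -ltzD1 -(ltr_int R) intrD; rewrite -/z0 in z0l; lra.
exists `|(z - z0)%R|%N; last first.
  have -> : z0 + `|(z - z0)%R|%N = z by rewrite gez0_abs ?subr_ge0 // addrC subrK.
  by apply/pieceP => //; rewrite h1.
rewrite ltnS truncn_ge_nat; last first.
  by rewrite addr_ge0 // mulr_ge0 //; lra.
rewrite pmulrn gez0_abs ?subr_ge0 // intrB.
move: lz0; rewrite intrD -/z0; lra.
Qed.

Lemma cell_circle (R : realType) K k (a : 'I_K) : (0 < K)%N -> (0 < k)%N ->
  (`[0 : R, 1[%classic `&` [set x : R | cell a (k%:R * x)]) =
  \big[setU/set0]_(z < k) piece k a z%:Z.
Proof.
move=> K0 k0; have K0' : 0 < K%:R :> R by rewrite ltr0n.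
have k0' : 0 < k%:R :> R by rewrite ltr0n.
have a1 : a.+1%:R / K%:R <= 1 :> R by rewrite ler_pdivrMr // mul1r ler_nat ltn_ord.
have a0 : 0 <= a%:R / K%:R :> R by rewrite divr_ge0.
rewrite -(bigcup_mkord k (fun z => piece k a z%:Z)); apply/seteqP; split=> x /=.
  rewrite in_itv /= => -[/andP[x0 x1] [z /[dup] hz /andP[h1 h2]]].
  have kx1 : k%:R * x < k%:R by rewrite gtr_pMr.
  have kx0 : 0 <= k%:R * x by rewrite mulr_ge0 // ltW.
  have z0 : 0 <= z by rewrite -ltzD1 -(ltr_int R) intrD; lra.
  case: z z0 hz h1 h2 => // z _ hz h1 h2; exists z; last by apply/pieceP.
  by rewrite /= -(ltr_nat R); lra.
move=> [z /= zk /(pieceP _ _ _ K0 k0) /[dup] hz /andP[h1 h2]]; split; last by exists z%:Z.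
have z1k : z%:R + 1 <= k%:R :> R by rewrite natr1 ler_nat.
have z0 : 0 <= z%:R :> R by [].
rewrite -pmulrn in h1 h2.
rewrite in_itv /= -(pmulr_rge0 _ k0') -(ltr_pM2l k0') mulr1; lra.
Qed.

(** The pairs of ks are made of a frequency and of the cell prescribed to it. *)
Definition visits {R : realType} {K : nat} (ks : seq (nat * 'I_K)) : set R :=
  [set x | forall p, p \in ks -> cell p.2 (p.1%:R * x)].

(** Induction on the frequencies, from the highest to the lowest.  An interval of
    length 1 / (K kappa) meets at most k / (K kappa) + 2 periods of the lowest
    frequency k, each of which contains one piece of length 1 / (K k), to which the
    induction hypothesis applies with k in place of kappa.  Since k >= lambda kappa,
    the boundary term 2 / k is at most 2 / (lambda kappa), so the error stays a
    constant factor for each frequency. *)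
Lemma lebesgue_visits_itv (R : realType) K (lambda : R) (ks : seq (nat * 'I_K)) :
  (0 < K)%N -> 0 < lambda ->
  forall (kappa : nat) (al : R), (0 < kappa)%N ->
  path (fun p q : nat => lambda * p%:R <= q%:R) kappa (unzip1 ks) ->
  (lebesgue (`[al, al + (K * kappa)%:R^-1[%classic `&` visits ks : set R)%R <=
    ((K%:R^-1 + 2 / lambda) ^+ (size ks).+1 / kappa%:R)%:E)%E.
Proof.
move=> K0 lambda0; have K0' : 0 < K%:R :> R by rewrite ltr0n.
set rho := _ + _; have rho0 : 0 <= rho by rewrite addr_ge0 ?invr_ge0 ?divr_ge0 ?ltW.
elim: ks => [|[k a] ks IH] kappa al kappa0.
  move=> _; have kp0' : 0 < kappa%:R :> R by rewrite ltr0n.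
  apply: le_trans (le_lebesgue (@subIsetl _ _ _)) _.
  rewrite lebesgue_itv ?lerDl ?invr_ge0 // [al + _]addrC addrK lee_fin expr1.
  rewrite natrM invfM; apply: ler_wpM2r; first by rewrite invr_ge0.
  by rewrite /rho lerDl divr_ge0 ?ltW.
move=> /= /andP[kk path_ks]; set l := (K * kappa)%:R^-1.
have kp0' : 0 < kappa%:R :> R by rewrite ltr0n.
have k0' : 0 < k%:R :> R by apply: lt_le_trans kk; rewrite mulr_gt0.
have k0 : (0 < k)%N by rewrite -(ltr0n R).
have l0 : 0 <= l by rewrite invr_ge0.
pose M := (Num.truncn (1 + k%:R * l)).+1.
pose F i := piece k a (Num.floor (k%:R * al) + i%:Z) `&` visits ks : set R.
apply: le_trans (_ : (\sum_(i < M) lebesgue (F i) <= _)%E).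
  apply: lebesgue_subadditive_nat => x [/=]; rewrite in_itv /= => xal vis.
  have := vis (k, a) (mem_head _ _) => /=.
  case/(cell_itv_cover K0 k0 xal) => i iM Fi; exists i => //; split=> //.
  by move=> p pks; apply: vis; rewrite inE pks orbT.
apply: le_trans (_ : (\sum_(i < M) (rho ^+ (size ks).+1 / k%:R)%:E <= _)%E).
  by apply: lee_sum => i _; exact: IH.
rewrite sumEFin lee_fin sumr_const card_ord -[_ *+ M]mulr_natr.
have M2 : M%:R <= 2 + k%:R * l.
  have kl0 : 0 <= 1 + k%:R * l by rewrite addr_ge0 // mulr_ge0 // ltW.
  have /andP[+ _] := truncn_itv kl0.
  by rewrite /M -natr1; lra.
rewrite [rho ^+ _.+2]exprSr -!mulrA; apply: ler_wpM2l; first exact: exprn_ge0.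
apply: le_trans (ler_wpM2l _ M2) _; first by rewrite invr_ge0 ltW.
have -> : k%:R^-1 * (2 + k%:R * l) = 2 / k%:R + l by field; rewrite gt_eqF.
have -> : rho / kappa%:R = 2 / lambda / kappa%:R + l.
  by rewrite /rho /l natrM invfM mulrDl addrC.
rewrite lerD2r -mulrA ler_pM2l // -invfM.
by rewrite lef_pV2 // posrE mulr_gt0.
Qed.

(** The circle is made of exactly k periods of the lowest frequency k, so that no
    boundary term appears at the first step; the bound is then meaningful for all N. *)
Lemma lebesgue_visits (R : realType) K (lambda : R) (ks : seq (nat * 'I_K)) :
  (0 < K)%N -> 0 < lambda -> (0 < size ks)%N -> all (leq 1) (unzip1 ks) ->
  sorted (fun p q : nat => lambda * p%:R <= q%:R) (unzip1 ks) ->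
  (lebesgue (`[0 : R, 1[%classic `&` visits ks : set R)%R <=
    ((K%:R^-1 + 2 / lambda) ^+ size ks)%:E)%E.
Proof.
case: ks => // -[k a] ks K0 lambda0 _ /= /andP[k0 _] path_ks.
have k0' : 0 < k%:R :> R by rewrite ltr0n.
pose F i := piece k a i%:Z `&` visits ks : set R.
apply: le_trans (_ : (\sum_(i < k) lebesgue (F i) <= _)%E).
  apply: lebesgue_subadditive_nat => x [x01 vis].
  have : (`[0 : R, 1[%classic `&` [set x : R | cell a (k%:R * x)]) x.
    by split=> //; exact: vis (k, a) (mem_head _ _).
  rewrite cell_circle // -(bigcup_mkord k (fun z => piece k a z%:Z)) => -[i ik Fi].
  by exists i => //; split=> // p pks; apply: vis; rewrite inE pks orbT.
apply: le_trans (_ : (\sum_(i < k) ((K%:R^-1 + 2 / lambda) ^+ (size ks).+1 / k%:R)%:E <= _)%E).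
  by apply: lee_sum => i _; exact: lebesgue_visits_itv.
by rewrite sumEFin lee_fin sumr_const card_ord -[(_ / _) *+ k]mulr_natr divfK ?gt_eqF.
Qed.

Lemma lebesgue_pattern (R : realType) K (lambda : R) N (k : 'I_N -> nat)
    (s : {ffun 'I_N -> 'I_K}) :
  (0 < K)%N -> 0 < lambda -> (0 < N)%N -> lacunary lambda k ->
  (lebesgue (`[0 : R, 1[%classic `&` [set x : R | forall i, cell (s i) ((k i)%:R * x)] : set R)%R
    <= ((K%:R^-1 + 2 / lambda) ^+ N)%:E)%E.
Proof.
move=> K0 lambda0 N0 [k0 klac].
pose ks := [seq (k i, s i) | i <- enum 'I_N].
have szks : size ks = N by rewrite size_map size_enum_ord.
have uks : unzip1 ks = [seq k i | i <- enum 'I_N] by rewrite /unzip1 -map_comp.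
have ks1 : all (leq 1) (unzip1 ks) by rewrite uks; apply/allP => _ /mapP[i _ ->].
have ks_sorted : sorted (fun p q : nat => lambda * p%:R <= q%:R) (unzip1 ks).
  rewrite uks sorted_map.
  have : sorted (relpre val (fun p q => q == p.+1)) (enum 'I_N).
    rewrite -sorted_map val_enum_ord; case: (N) => //= n.
    by elim: n 0%N => //= n IH m; rewrite eqxx IH.
  apply: sub_sorted => i j /= /eqP ij; have := klac i j ij.
  by rewrite ler_pdivlMr // ltr0n.
have := lebesgue_visits K0 lambda0 _ ks1 ks_sorted; rewrite szks => /(_ N0).
apply: le_trans; apply: le_lebesgue => x [x01 hx]; split=> // p /mapP[i _ ->].
exact: hx.
Qed.

(** * Riemann integrable functions on a fine uniform partition *)

Definition base_cell {R : realType} (K a : nat) : set R :=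
  `[a%:R / K%:R, a.+1%:R / K%:R[.

Definition flat {R : realType} (phi : R -> R) (delta : R) (K a : nat) : Prop :=
  forall x y, base_cell K a x -> base_cell K a y -> `|phi x - phi y| <= delta.

Definition uniform_partition (R : realType) (K : nat) : seq R :=
  [seq i.+1%:R / K%:R | i <- iota 0 K].

Lemma nth_uniform_partition (R : realType) K i : (i <= K)%N ->
  nth 0 (0 :: uniform_partition R K) i = i%:R / K%:R.
Proof.
case: i => [|i] iK; first by rewrite /= mul0r.
by rewrite /= (nth_map 0%N) ?size_iota // nth_iota.
Qed.

Lemma uniform_partitionP (R : realType) K : (0 < K)%N ->
  itv_partition 0 1 (uniform_partition R K).
Proof.
move=> K0; have K0' : 0 < K%:R :> R by rewrite ltr0n.
have sz : size (uniform_partition R K) = K by rewrite size_map size_iota.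
split; last first.
  by rewrite (last_nth 0) sz nth_uniform_partition // divff // gt_eqF.
apply/(pathP 0) => i; rewrite sz => iK.
rewrite nth_uniform_partition; last exact: ltnW.
have := @nth_uniform_partition R K i.+1 iK => /= ->.
by rewrite ltr_pM2r ?invr_gt0 // ltr_nat.
Qed.

Lemma base_cell_left (R : realType) K a : (0 < K)%N -> base_cell K a (a%:R / K%:R : R).
Proof.
move=> K0; rewrite /base_cell /= in_itv /= lexx /= ltr_pM2r ?invr_gt0 ?ltr0n //.
by rewrite ltr_nat leqnn.
Qed.

(** Two Riemann sums of the same fine partition differ by less than delta eta.  Take
    the tags equal on the flat cells, and on the other cells at two points where phi
    differs by more than delta: each such cell contributes delta / K at least. *)
Lemma few_nonflat_cells (R : realType) (phi : R -> R) (delta eta : R) :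
  riemann_integrable phi 0 1 -> 0 < delta -> 0 < eta ->
  exists K0 : nat, forall K, (0 < K)%N -> (K0 <= K)%N ->
  #|[pred a : 'I_K | ~~ `[< flat phi delta K a >]]|%:R <= eta * K%:R.
Proof.
move=> [I hI] delta0 eta0; set e := delta * eta / 2.
have e0 : 0 < e by rewrite divr_gt0 // mulr_gt0.
have [d d0 hd] := hI e e0.
exists (Num.truncn d^-1).+1 => K K0 dK; have K0' : 0 < K%:R :> R by rewrite ltr0n.
have Kd : K%:R^-1 < d.
  rewrite -[d]invrK ltf_pV2 ?posrE ?invr_gt0 //.
  apply: lt_le_trans (_ : (Num.truncn d^-1).+1%:R <= _); last by rewrite ler_nat.
  have d0' : 0 <= d^-1 by rewrite invr_ge0 ltW.
  by have /andP[] := truncn_itv d0'.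
have /choice[p hp] : forall i : nat, exists p : R * R,
    [/\ base_cell K i p.1, base_cell K i p.2 &
        delta * (~~ `[< flat phi delta K i >])%:R <= phi p.1 - phi p.2].
  move=> i; case: asboolP => [_|nf] /=.
    by exists (i%:R / K%:R, i%:R / K%:R); rewrite mulr0 subrr; split=> //; exact: base_cell_left.
  move/existsNP: nf => [x /existsNP[y /not_implyP[hx /not_implyP[hy]]]].
  move/negP; rewrite -ltNge lter_normr mulr1 => /orP[h|h].
    by exists (x, y); split=> //; exact: ltW.
  by exists (y, x); split=> //; rewrite /= -opprB; exact: ltW.
pose s := uniform_partition R K.
have sz : size s = K by rewrite size_map size_iota.
have nthS i : (i < K)%N -> nth 0 (0 :: s) i.+1 - nth 0 (0 :: s) i = K%:R^-1.
  move=> iK; rewrite !nth_uniform_partition //; last exact: ltnW.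
  by rewrite -mulrBl -natr1 addrC addKr mul1r.
have fine_s : finer_than 0 s d by move=> i; rewrite sz => iK; rewrite nthS.
have tagged t : (forall i, base_cell K i (t i)) -> tagged_partition 0 1 s t.
  move=> ht; split; first exact: uniform_partitionP.
  move=> i; rewrite sz => iK; rewrite !nth_uniform_partition //; last exact: ltnW.
  by have := ht i; rewrite /base_cell /= in_itv /= => /andP[-> /ltW].
have sumE t : riemann_sum phi 0 s t = (\sum_(i < K) phi (t i)) / K%:R.
  rewrite /riemann_sum sz mulr_suml; apply: eq_bigr => i _; congr (_ * _).
  by rewrite -(nthS i).
have h1 := hd s (fst \o p) (tagged _ (fun i => let: And3 h _ _ := hp i in h)) fine_s.
have h2 := hd s (snd \o p) (tagged _ (fun i => let: And3 _ h _ := hp i in h)) fine_s.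
have h3 : (\sum_(i < K) (phi (p i).1 - phi (p i).2)) / K%:R < delta * eta.
  rewrite sumrB mulrBl; rewrite !sumE in h1 h2.
  move: h1 h2; rewrite !ltr_norml => /andP[_ h1] /andP[h2 _].
  have : e + e = delta * eta by rewrite /e; field.
  rewrite /= in h1 h2 *; lra.
rewrite -(ler_pM2l delta0) mulrA -ler_pdivrMr //; apply/ltW.
apply: le_lt_trans h3; rewrite ler_pM2r ?invr_gt0 //.
rewrite -sum1_card natr_sum mulr_sumr big_mkcond /=.
apply: ler_sum => i _; have [_ _] := hp i; apply: le_trans.
by rewrite inE; case: ifP; rewrite ?mulr0.
Qed.

(** Otherwise, any lower bound of phi on a cell is at most any upper bound of phi on
    a cell, and c, the supremum of all the lower bounds, lies within 2 delta of phi on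
    each delta-flat cell.  As the other cells have arbitrarily small total measure,
    phi = c almost everywhere. *)
Lemma separated_cells (R : realType) (phi : R -> R) :
  riemann_integrable phi 0 1 ->
  (forall c : R, (0 < circle_measure [set x | phi x <> c])%E) ->
  exists t t' : R, t' < t /\ exists K1 K2 a1 a2 : nat,
  [/\ (a1 < K1)%N, (a2 < K2)%N, forall x, base_cell K1 a1 x -> t <= phi x &
      forall x, base_cell K2 a2 x -> phi x <= t'].
Proof.
move=> phi_int phi_nc; apply: contrapT => Hn.
have H t t' K1 K2 a1 a2 : (a1 < K1)%N -> (a2 < K2)%N ->
    (forall x, base_cell K1 a1 x -> t <= phi x) ->
    (forall x, base_cell K2 a2 x -> phi x <= t') -> t <= t'.
  move=> h1 h2 h3 h4; rewrite leNgt; apply/negP => tt'; apply: Hn.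
  by exists t, t'; split=> //; exists K1, K2, a1, a2.
pose S : set R := [set t | exists K a : nat, (a < K)%N /\
  forall x, base_cell K a x -> t <= phi x].
have flatS K a delta : (a < K)%N -> flat phi delta K a ->
    S (phi (a%:R / K%:R) - delta) /\ ubound S (phi (a%:R / K%:R) + delta).
  move=> aK hflat; have K0 : (0 < K)%N by lia.
  have hc := @base_cell_left R K a K0; split.
    exists K, a; split=> // x hx; have := hflat _ _ hc hx.
    by rewrite ler_norml => /andP[]; lra.
  move=> t [K' [a' [aK' ht]]]; apply: (H t _ K' K a' a) => // x hx.
  by have := hflat _ _ hc hx; rewrite ler_norml => /andP[]; lra.
have exflat delta : 0 < delta -> exists K a : nat, (a < K)%N /\ flat phi delta K a.
  move=> delta0; have h2 : 0 < 2^-1 :> R by rewrite invr_gt0.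
  have [K0 hK0] := few_nonflat_cells phi_int delta0 h2.
  apply: contrapT => hno; have := hK0 K0.+1 isT (leqnSn _).
  rewrite (eq_card (B := 'I_K0.+1)) ?card_ord; last first.
    move=> a; rewrite !inE; apply/asboolP => ha; apply: hno.
    by exists K0.+1, a.
  have : 0 < K0.+1%:R :> R by []. 
  lra.
pose c := sup S.
have S_sup : has_sup S.
  have [K [a [aK hflat]]] := exflat 1 ltr01; have [h1 h2] := flatS _ _ _ aK hflat.
  by split; [exists (phi (a%:R / K%:R) - 1) | exists (phi (a%:R / K%:R) + 1)].
have flat_c K a delta x : (a < K)%N -> flat phi delta K a -> base_cell K a x ->
    `|phi x - c| <= 2 * delta.
  move=> aK hflat hx; have [h1 h2] := flatS _ _ _ aK hflat.
  have K0 : (0 < K)%N by lia.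
  have hc := @base_cell_left R K a K0.
  have h3 : phi (a%:R / K%:R) - delta <= c by apply: ub_le_sup => //; case: S_sup.
  have h4 : c <= phi (a%:R / K%:R) + delta by apply: ge_sup => //; case: S_sup.
  have := hflat _ _ hc hx; rewrite !ler_norml => /andP[]; lra.
have null delta : 0 < delta ->
    lebesgue ([set x | 2 * delta < `|phi x - c|] `&` `[0 : R, 1[%classic : set R) = 0%E.
  move=> delta0; apply/eqP; rewrite eq_le measure_ge0 andbT.
  apply/lee_addgt0Pr => eta eta0; rewrite add0e.
  have [K0 hK0] := few_nonflat_cells phi_int delta0 eta0.
  pose K := K0.+1; have {}hK0 := hK0 K isT (leqnSn _).
  have K1 : 0 < K%:R :> R by [].
  pose F (a : nat) : set R := if `[< flat phi delta K a >] then set0 else base_cell K a.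
  apply: le_trans (_ : (\sum_(a < K) lebesgue (F a) <= _)%E).
    apply: lebesgue_subadditive_nat => x [/= hx]; rewrite in_itv /= => /andP[x0 x1].
    pose a := Num.truncn (x * K%:R).
    have xK0 : 0 <= x * K%:R by rewrite mulr_ge0.
    have /andP[ha1 ha2] := truncn_itv xK0.
    have aK : (a < K)%N.
      by rewrite -(ltr_nat R); apply: le_lt_trans ha1 _; rewrite gtr_pMl.
    have xa : base_cell K a x by rewrite /base_cell /= in_itv /= ler_pdivrMr // ltr_pdivlMr // ha1.
    exists a => //; rewrite /F; case: asboolP => // hflat.
    by have := flat_c _ _ _ _ aK hflat xa; rewrite leNgt hx.
  apply: le_trans (_ : ((\sum_(a < K) ((~~ `[< flat phi delta K a >])%:R / K%:R)%:E <= _)%E)).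
    apply: lee_sum => a _; rewrite /F; case: asboolP => _ /=.
      by rewrite measure0 mul0r.
    rewrite lebesgue_itv; last by rewrite ler_pM2r ?invr_gt0 // ler_nat.
    by rewrite -mulrBl -natr1 addrC addKr.
  rewrite sumEFin lee_fin -mulr_suml ler_pdivrMr //; apply: le_trans hK0.
  rewrite -sum1_card natr_sum [leRHS]big_mkcond /=.
  by apply: ler_sum => a _; rewrite inE; case: ifP.
have := phi_nc c; apply/negP; rewrite -leNgt.
pose G n : set R := [set x | 2 * n.+1%:R^-1 < `|phi x - c|] `&` `[0 : R, 1[%classic.
apply: le_trans (le_lebesgue (_ : _ `<=` \bigcup_n G n)) _.
  move=> x [/= hx x01]; have d0 : 0 < `|phi x - c|.
    by rewrite normr_gt0 subr_eq0; apply/eqP.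
  exists (Num.truncn (2 / `|phi x - c|)) => //; split=> //=.
  have h0 : 0 <= 2 / `|phi x - c| by rewrite divr_ge0.
  have /andP[_ h] := truncn_itv h0.
  by rewrite ltr_pdivrMr // -ltr_pdivrMl // mulrC.
apply: le_trans (outer_measure_sigma_subadditive (wlength (@idfun R))^*%mu G) _.
by rewrite eseries0 // => n _ _; exact: null.
Qed.

(** Two cells with separated values, brought to a common denominator K1, are each
    subdivided into L cells of the partition in K1 L cells.  Whatever l is, the values
    of phi on one of these two blocks are at distance at least (t - t') / 2 from l, so
    that a proportion 1 / K1 of the terms is at most q < 1. *)
Lemma gaussian_cells (R : realType) (phi : R -> R) :
  riemann_integrable phi 0 1 ->
  (forall c : R, (0 < circle_measure [set x | phi x <> c])%E) ->
  exists K1 : nat, exists kappa : R, [/\ (0 < K1)%N, 0 < kappa &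
    forall L l, (0 < L)%N ->
      \sum_(a < K1 * L) expR (- (phi (a%:R / (K1 * L)%:R) - l) ^+ 2) <=
      (K1 * L)%:R * expR (- kappa)].
Proof.
move=> phi_int phi_nc.
have [t [t' [tt' [K1 [K2 [a1 [a2 [aK1 aK2 h1 h2]]]]]]]] := separated_cells phi_int phi_nc.
have [K KE] : exists K, K = (K1 * K2)%N by exists (K1 * K2)%N.
have K10 : (0 < K1)%N := leq_ltn_trans (leq0n _) aK1.
have K20 : (0 < K2)%N := leq_ltn_trans (leq0n _) aK2.
have K0 : (0 < K)%N by rewrite KE muln_gt0 K10.
have K0' : 0 < K%:R :> R by rewrite ltr0n.
pose q := expR (- ((t - t') / 2) ^+ 2).
have q1 : q < 1 by rewrite expR_lt1 oppr_lt0 exprn_gt0 // divr_gt0 // subr_gt0.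
have q0 : 0 < q by exact: expR_gt0.
pose theta := 1 - (1 - q) / K%:R.
have K1' : 1 <= K%:R :> R by rewrite ler1n.
have theta1 : theta < 1 by rewrite /theta ltrBlDr ltrDl divr_gt0 // subr_gt0.
have theta0 : 0 < theta.
  rewrite /theta subr_gt0 ltr_pdivrMr // mul1r; lra.
exists K, (- ln theta); split=> //; first by rewrite oppr_gt0 ln_lt0 // theta0.
move=> L l L0; rewrite opprK lnK ?posrE //.
have L0' : 0 < L%:R :> R by rewrite ltr0n.
pose F a : R := expR (- (phi (a%:R / (K * L)%:R) - l) ^+ 2).
have F1 a : F a <= 1 by rewrite expR_le1 oppr_le0 sqr_ge0.
have block b : (b < K)%N -> (forall a, (b * L <= a < b.+1 * L)%N -> F a <= q) ->
    \sum_(a < K * L) F a <= (K * L)%:R * theta.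
  move=> bK hb; rewrite -(big_mkord xpredT F).
  have h3 : (b.+1 * L <= K * L)%N by rewrite leq_mul2r bK orbT.
  have h4 : (b * L <= b.+1 * L)%N by rewrite leq_mul2r leqnSn orbT.
  rewrite (big_cat_nat (leq0n _) h3) /= (big_cat_nat (leq0n _) h4) /=.
  have s1 : \sum_(0 <= a < b * L) F a <= (b * L)%:R.
    rewrite -[X in _ <= X%:R]subn0 -sumr_const_nat; exact: ler_sum.
  have s2 : \sum_(b.+1 * L <= a < K * L) F a <= (K * L - b.+1 * L)%:R.
    rewrite -sumr_const_nat; exact: ler_sum.
  have s3 : \sum_(b * L <= a < b.+1 * L) F a <= L%:R * q.
    apply: le_trans (_ : \sum_(b * L <= a < b.+1 * L) q <= _).
      by rewrite big_nat [leRHS]big_nat; apply: ler_sum => a /hb.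
    by rewrite sumr_const_nat mulSn addnK mulr_natl.
  apply: le_trans (lerD (lerD s1 s3) s2) _.
  rewrite natrB // natrM mulSn natrD !natrM /theta.
  have -> : K%:R * L%:R * (1 - (1 - q) / K%:R) = K%:R * L%:R - L%:R * (1 - q) :> R.
    by field; rewrite gt_eqF.
  lra.
have sub_cell M M' b a : (0 < M)%N -> (0 < M')%N -> (b * M' <= a < b.+1 * M')%N ->
    base_cell M b (a%:R / (M * M')%:R : R).
  move=> M0 M'0 /andP[ha1 ha2]; rewrite /base_cell /= in_itv /=.
  have M0' : 0 < M%:R :> R by rewrite ltr0n.
  have M'0' : 0 < M'%:R :> R by rewrite ltr0n.
  have -> : a%:R / (M * M')%:R = (a%:R / M'%:R) / M%:R :> R.
    by rewrite natrM; field; rewrite !gt_eqF.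
  rewrite ler_pM2r ?invr_gt0 // ltr_pM2r ?invr_gt0 //.
  by rewrite ler_pdivlMr // ltr_pdivrMr // -!natrM ler_nat ltr_nat ha1.
have far x : (t - t') / 2 <= `|x| -> expR (- x ^+ 2) <= q.
  move=> hx; rewrite ler_expR lerN2 -[x ^+ 2]real_normK ?num_real // lerXn2r ?nnegrE //.
  by rewrite divr_ge0 // subr_ge0 ltW.
have sub_block M b a : (0 < M)%N -> (b * M * L <= a < (b * M).+1 * L)%N ->
    (b * (M * L) <= a < b.+1 * (M * L))%N.
  move=> M0 /andP[ha1 ha2]; rewrite !mulnA ha1 /=; apply: leq_trans ha2 _.
  by rewrite leq_mul2r mulSn -add1n leq_add2r M0 orbT.
have [ll|ll] := leP l ((t + t') / 2).
- apply: (block (a1 * K2)%N) => [|a ha]; first by rewrite KE ltn_mul2r K20.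
  apply: far; have h : t <= phi (a%:R / (K * L)%:R).
    rewrite KE -mulnA; apply/h1/sub_cell; rewrite ?muln_gt0 ?K20 //.
    exact: sub_block.
  by rewrite ler_normr; apply/orP; left; lra.
- apply: (block (a2 * K1)%N) => [|a ha].
    by rewrite KE (mulnC K1 K2) ltn_mul2r K10.
  apply: far; have h : phi (a%:R / (K * L)%:R) <= t'.
    rewrite KE (mulnC K1) -mulnA; apply/h2/sub_cell; rewrite ?muln_gt0 ?K10 //.
    exact: sub_block.
  by rewrite ler_normr; apply/orP; right; lra.
Qed.

(** * Functions far from a dilate, and their distance to it *)

Local Notation lebesgueR R := (caratheodory_type ((wlength (@idfun R))^*)%mu).

Lemma measurable_lebesgue_itv (R : realType) (i : interval R) :
  measurable ([set` i] : set (lebesgueR R)).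
Proof. by apply: sub_caratheodory; exact: measurable_itv. Qed.

Lemma measurable_cell (R : realType) K k (a : 'I_K) : (0 < K)%N -> (0 < k)%N ->
  measurable (`[0 : R, 1[%classic `&` [set x : R | cell a (k%:R * x)] : set (lebesgueR R)).
Proof.
move=> K0 k0; rewrite cell_circle //; apply: bigsetU_measurable => i _.
exact: measurable_lebesgue_itv.
Qed.

Lemma lebesgue_cell (R : realType) K k (a : 'I_K) : (0 < K)%N -> (0 < k)%N ->
  (lebesgue (`[0 : R, 1[%classic `&` [set x : R | cell a (k%:R * x)] : set R)%R
    <= (K%:R^-1)%:E)%E.
Proof.
move=> K0 k0; apply: le_trans (_ : (\sum_(z < k) ((K * k)%:R^-1)%:E <= _)%E).
  apply: le_trans (_ : (\sum_(z < k) lebesgue (piece k a z%:Z : set R) <= _)%E).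
    apply: (lebesgue_subadditive_nat (F := fun z : nat => piece k a z%:Z)) => x; rewrite cell_circle //.
    by rewrite -(bigcup_mkord k (fun z => piece k a z%:Z)) => -[z zk hz]; exists z.
  by apply: lee_sum => z _; rewrite lebesgue_piece.
rewrite sumEFin lee_fin sumr_const card_ord natrM invfM -[_ *+ k]mulr_natr.
by rewrite divfK // pnatr_eq0 -lt0n.
Qed.

Lemma markov_count d (T : measurableType d) (R : realType)
    (mu : {measure set T -> \bar R}) (I : Type) (s : seq I) (M : I -> set T) (r : R) :
  (forall i, measurable (M i)) -> 0 <= r ->
  (r%:E * mu [set x | r <= \sum_(i <- s) \1_(M i) x]%R <= \sum_(i <- s) mu (M i))%E.
Proof.
move=> mM r0; set X := [set x | _].
have mf : measurable_fun setT (fun x => \sum_(i <- s) \1_(M i) x : R).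
  by apply: measurable_sum => i; apply/measurable_indic.
have mX : measurable X.
  have := mf measurableT `[r, +oo[%classic (measurable_itv _).
  by rewrite setTI; congr measurable; apply/seteqP; split=> x /=; rewrite in_itv /= andbT.
rewrite -integral_cst //.
have mE i : measurable_fun setT (fun x => (\1_(M i) x : R)%:E).
  by apply/measurable_EFinP/measurable_indic.
apply: le_trans (_ : (\int[mu]_(x in X) (\sum_(i <- s) (\1_(M i) x : R)%:E) <= _)%E).
  apply: ge0_le_integral => //.
  - by apply: emeasurable_sum => i; apply: measurable_funS (mE i).
  - by move=> x Xx; rewrite sumEFin lee_fin.
apply: le_trans (_ : (\int[mu]_x (\sum_(i <- s) (\1_(M i) x : R)%:E) <= _)%E).
  apply: ge0_subset_integral => //.
  - by apply: emeasurable_sum => i.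
  - by move=> x _; rewrite sumEFin lee_fin sumr_ge0.
rewrite ge0_integral_sum //.
by apply: lee_sum => i _; rewrite integral_indic // setIT.
Qed.

(** A measurable set of points where phi (k x) and y x differ by at least tau.
    The dilate is replaced by its value at the left end of the cell of k x, which
    makes the set measurable, and only the flat cells are kept, where this costs at
    most tau. *)
Definition far_set {R : realType} (phi : R -> R) (tau : R) (K k : nat) (y : R -> R) : set R :=
  `[0, 1[%classic `&` [set x | exists a : 'I_K,
    [/\ flat phi tau K a, cell a (k%:R * x) & 2 * tau <= `|phi (a%:R / K%:R) - y x|]].

Lemma measurable_far_set (R : realType) (phi : R -> R) tau K k y :
  (0 < K)%N -> (0 < k)%N -> L0 y ->
  measurable (far_set phi tau K k y : set (lebesgueR R)).
Proof.
move=> K0 k0 [_ my].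
have -> : far_set phi tau K k y = \big[setU/set0]_(a < K | `[< flat phi tau K a >])
   ((`[0 : R, 1[%classic `&` [set x : R | cell a (k%:R * x)]) `&`
    (setT `&` y @^-1` [set r | 2 * tau <= `|phi (a%:R / K%:R) - r|])).
  apply/seteqP; split=> [x [x01 [a [hflat xa hy]]]|x].
    by apply/bigsetUP; exists a; [apply/asboolP | split].
  by move/bigsetUP => [a /asboolP hflat [[x01 xa] [_ hy]]]; split=> //; exists a.
apply: bigsetU_measurable => a _; apply: measurableI; first exact: measurable_cell.
apply: my => //.
have mabs : measurable_fun setT (fun r : R => `|phi (a%:R / K%:R) - r|).
  apply: measurableT_comp => //; apply: measurable_funB => //.
have := mabs measurableT `[2 * tau, +oo[%classic (measurable_itv _).
by rewrite setTI; congr measurable; apply/seteqP; split=> x /=; rewrite in_itv /= andbT.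
Qed.

Lemma periodic_int (R : realType) (phi : R -> R) (z : int) x :
  periodic phi 1 -> phi (z%:~R + x) = phi x.
Proof.
move=> per; case: z => n; first by rewrite -pmulrn addrC -(periodicn per n x).
rewrite NegzE mulrNz -[in RHS](addrNK n.+1%:R x) [- _ + x]addrC.
by rewrite -pmulrn (periodicn per).
Qed.

Lemma far_setP (R : realType) (phi : R -> R) tau K k y x :
  periodic phi 1 -> (0 < K)%N -> far_set phi tau K k y x ->
  tau <= `|phi (k%:R * x) - y x|.
Proof.
move=> per K0 [_ [a [hflat [z /andP[h1 h2]] h3]]].
have hx : base_cell K a (k%:R * x - z%:~R).
  by rewrite /base_cell /= in_itv /= lerBrDl ltrBlDl h1.
have := hflat _ _ hx (@base_cell_left R K a K0).
have -> : phi (k%:R * x - z%:~R) = phi (k%:R * x) by rewrite -(periodic_int z) // addrC subrK.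
move=> h4; move: h3.
rewrite (_ : phi (a%:R / K%:R) - y x =
  (phi (k%:R * x) - y x) - (phi (k%:R * x) - phi (a%:R / K%:R))); last by ring.
move=> h3; have := ler_normB (phi (k%:R * x) - y x) (phi (k%:R * x) - phi (a%:R / K%:R)).
lra.
Qed.

Lemma L0norm_far (R : realType) (phi : R -> R) tau K k y :
  periodic phi 1 -> (0 < K)%N -> 0 <= tau ->
  (tau%:E <= lebesgue (far_set phi tau K k y))%E ->
  (tau%:E <= L0norm ((fun x => phi (k%:R * x)) \- y)%R)%E.
Proof.
move=> per K0 tau0 h; apply: ereal_sup_ubound; exists tau => //=; split=> //.
apply: le_trans h _; apply: le_lebesgue => x hx; split; last by case: hx.
exact: far_setP hx.
Qed.

(** The integral of a nonnegative function is a supremum over the simple functions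
    below it, so that the lower bound by the indicator of the measurable set far_set
    passes to the integral; this spares a proof that the dilate is measurable. *)
Lemma L1norm_far (R : realType) (phi : R -> R) tau K k y :
  periodic phi 1 -> (0 < K)%N -> (0 < k)%N -> 0 <= tau -> L0 y ->
  (tau%:E <= lebesgue (far_set phi tau K k y))%E ->
  ((tau * tau)%R%:E <= L1norm ((fun x => phi (k%:R * x)) \- y)%R)%E.
Proof.
move=> per K0 k0 tau0 Ly h; have mF := measurable_far_set phi tau K0 k0 Ly.
rewrite /L1norm ge0_integralE; last by move=> x _; rewrite lee_fin.
rewrite EFinM; apply: le_trans (lee_wpmul2l _ h) _; first by rewrite lee_fin.
rewrite -[leLHS]integral_cst // ge0_integralE; last by move=> x _; rewrite lee_fin.
apply: le_ereal_sup => _ /= [g hg <-]; exists g => // x.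
apply: le_trans (hg x) _; rewrite /patch; case: ifPn => [|_]; last first.
  by case: ifP => _; rewrite lee_fin.
rewrite inE => /[dup] hx [x01 _]; rewrite mem_set //= lee_fin.
exact: far_setP hx.
Qed.

(** * Most dilates are far from a small subspace *)

(** The dilates that no element of Q approximates in measure. *)
Definition far_indices {R : realType} (phi : R -> R) (tau : R) (K N : nat)
    (k : 'I_N -> nat) (Q : set (R -> R)) : pred 'I_N :=
  [pred i : 'I_N | `[< forall y, Q y ->
     (tau%:E <= lebesgue (far_set phi tau K (k i) y))%E >]].

(** The set M i gathers the points where y i is far from the dilate and those where
    k_i x falls in a cell that is not flat; both have measure at most tau. *)
Lemma exceptional_set (R : realType) (phi : R -> R) (tau b : R) (K N : nat) (k : 'I_N -> nat)
    (y : 'I_N -> R -> R) (J : pred 'I_N) :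
  (0 < N)%N -> (0 < K)%N -> 0 <= tau -> (forall i, 0 < k i)%N -> (forall i, L0 (y i)) -> 0 < b ->
  #|[pred a : 'I_K | ~~ `[< flat phi tau K a >]]|%:R <= tau * K%:R ->
  (forall i, J i -> (lebesgue (far_set phi tau K (k i) (y i)) <= tau%:E)%E) ->
  exists M : 'I_N -> set R,
  [/\ (lebesgue ([set x | b * N%:R <= \sum_(i <- enum J) \1_(M i) x]%R : set R) <=
         (2 * tau / b)%:E)%E,
      forall i x, `[0, 1[%classic x -> ~ M i x -> ~ far_set phi tau K (k i) (y i) x &
      forall i x a, `[0, 1[%classic x -> ~ M i x -> cell a ((k i)%:R * x) ->
         flat phi tau K (a : 'I_K)].
Proof.
move=> N0 K0 tau0 k0 Ly b0 few hJ; have K0' : 0 < K%:R :> R by rewrite ltr0n.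
pose W i : set R := \big[setU/set0]_(a < K | ~~ `[< flat phi tau K a >])
  (`[0 : R, 1[%classic `&` [set x : R | cell a ((k i)%:R * x)]).
pose M i : set R := far_set phi tau K (k i) (y i) `|` W i.
have mM i : measurable (M i : set (lebesgueR R)).
  apply: measurableU; first exact: measurable_far_set.
  by apply: bigsetU_measurable => a _; exact: measurable_cell.
have muM i : J i -> (lebesgue (M i) <= (2 * tau)%:E)%E.
  move=> Ji; apply: le_trans (outer_measureU2 (wlength (@idfun R))^*%mu _ _) _.
  rewrite mulr2n mulrDl mul1r EFinD; apply: leeD; first exact: hJ.
  apply: le_trans (_ : (\sum_(a < K | ~~ `[< flat phi tau K a >]) (K%:R^-1)%:E <= _)%E).
    apply: le_trans (lebesgue_subadditive _) _; last first.
      by apply: lee_sum => a _; exact: lebesgue_cell (k0 i).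
    by move=> x /bigsetUP.
  rewrite sumEFin lee_fin sumr_const -[K%:R^-1 *+ _]mulr_natl ler_pdivrMr //.
exists M; split.
- have bN : 0 < b * N%:R by rewrite mulr_gt0 // ltr0n.
  rewrite -(@lee_pmul2l _ (b * N%:R)%:E) // ?lte_fin //.
  apply: le_trans (markov_count (@lebesgue R) (enum J) mM (ltW bN)) _.
  apply: le_trans (_ : (\sum_(i <- enum J) (2 * tau)%:E <= _)%E).
    by rewrite !big_enum /=; apply: lee_sum => i; exact: muM.
  rewrite big_enum /= sumEFin -EFinM lee_fin sumr_const -[(2 * tau) *+ _]mulr_natl.
  rewrite (_ : b * N%:R * (2 * tau / b) = N%:R * (2 * tau)); last first.
    by field; rewrite gt_eqF.
  rewrite ler_wpM2r ?mulr_ge0 // ler_nat; apply: leq_trans (max_card _) _.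
  by rewrite card_ord.
- by move=> i x _ hM hfar; apply: hM; left.
- move=> i x a x01 hM xa; apply: contrapT => nf; apply: hM; right.
  by apply/bigsetUP; exists a => //; apply/asboolP.
Qed.

(** The constants are chosen in the order gamma, h, beta, tau.  The last inequality
    leaves a positive proportion of points outside the exceptional set of measure
    4 tau / beta and outside the set of measure at most exp (- gamma) given by the rare
    patterns; the others are the hypotheses of card_near_off_union for the tolerance
    2 tau. *)
Lemma constants_exist (R : realType) (kappa eps : R) : 0 < kappa -> 0 < eps ->
  exists gamma h beta tau : R,
  [/\ 0 < gamma, 0 <= h, 0 < beta & 0 < tau] /\
  [/\ 20 * gamma <= kappa * eps, expR (- h) <= gamma, beta <= eps / 2 &
      h * beta <= gamma] /\
  4 * (2 * tau) ^+ 2 <= gamma * eps /\ 4 * tau / beta + expR (- gamma) < 1.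
Proof.
move=> kappa0 eps0; have [gamma gammaE] : exists g, g = kappa * eps / 20 by eexists.
have gamma0 : 0 < gamma by rewrite gammaE divr_gt0 // mulr_gt0.
pose h := 1 + `|ln gamma|; have h0 : 0 < h by rewrite ltr_pwDl.
pose beta := Num.min (eps / 2) (gamma / h).
have beta0 : 0 < beta by rewrite lt_min ?divr_gt0.
pose rho := expR (- gamma); have rho1 : rho < 1 by rewrite expR_lt1 oppr_lt0.
pose tau := Num.min 1 (Num.min (gamma * eps / 16) (beta * (1 - rho) / 8)).
have tau0 : 0 < tau.
  by rewrite !lt_min ltr01 !divr_gt0 ?mulr_gt0 // subr_gt0.
have [tau1 tau2 tau3] :
    [/\ tau <= 1, tau <= gamma * eps / 16 & tau <= beta * (1 - rho) / 8].
  by split; rewrite /tau !ge_min lexx ?orbT.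
exists gamma, h, beta, tau; split; first by split=> //; exact: ltW.
split.
  split.
  - by rewrite gammaE mulrC divfK.
  - rewrite -[leRHS]lnK ?posrE // ler_expR /h.
    have := ler_norm (- ln gamma); rewrite normrN; lra.
  - by rewrite ge_min lexx.
  - by rewrite mulrC -ler_pdivlMr // ge_min lexx orbT.
split.
  have : tau * tau <= tau by rewrite ler_piMr // ltW.
  rewrite expr2; lra.
rewrite -/rho -ltrBrDr ltr_pdivrMr //.
have : 0 < beta * (1 - rho) by rewrite mulr_gt0 // subr_gt0.
lra.
Qed.

(** Half of the exponent - 2 gamma N pays for the factor (1 + 2 K / lambda)^N between
    the distribution of the pattern and the uniform distribution. *)
Lemma lebesgue_patterns (R : realType) (K : nat) (lambda : R) N (k : 'I_N -> nat) (gamma : R)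
    (E : {set {ffun 'I_N -> 'I_K}}) (X : set R) :
  (0 < K)%N -> 0 < lambda -> 2 * K%:R / lambda <= gamma -> (0 < N)%N -> lacunary lambda k ->
  #|E|%:R <= expR (- 2 * gamma * N%:R) * #|{ffun 'I_N -> 'I_K}|%:R ->
  (forall x, X x -> `[0, 1[%classic x /\
     exists2 s : {ffun 'I_N -> 'I_K}, s \in E & forall i, cell (s i) ((k i)%:R * x)) ->
  (lebesgue X <= (expR (- gamma * N%:R))%:E)%E.
Proof.
move=> K0 lambda0 le_lambda N0 klac cardE hX; have K0' : 0 < K%:R :> R by rewrite ltr0n.
pose D (s : {ffun 'I_N -> 'I_K}) : set R :=
  `[0 : R, 1[%classic `&` [set x : R | forall i, cell (s i) ((k i)%:R * x)].
apply: le_trans (_ : (\sum_(s in E) lebesgue (D s) <= _)%E).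
  by apply: lebesgue_subadditive => x /hX[x01 [s sE hs]]; exists s.
apply: le_trans (_ : (\sum_(s in E) ((K%:R^-1 + 2 / lambda) ^+ N)%:E <= _)%E).
  by apply: lee_sum => s _; exact: lebesgue_pattern.
rewrite sumEFin lee_fin sumr_const -[(_ ^+ N) *+ _]mulr_natl.
have rho_le : K%:R^-1 + 2 / lambda <= K%:R^-1 * expR gamma.
  have -> : K%:R^-1 + 2 / lambda = K%:R^-1 * (1 + 2 * K%:R / lambda).
    by field; rewrite !gt_eqF.
  rewrite ler_pM2l ?invr_gt0 //; apply: le_trans (expR_ge1Dx _) _.
  by rewrite ler_expR.
have rho0 : 0 <= K%:R^-1 + 2 / lambda by rewrite addr_ge0 ?invr_ge0 ?divr_ge0 // ltW.
apply: le_trans (ler_wpM2r (exprn_ge0 _ rho0) cardE) _.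
apply: le_trans (ler_wpM2l _ (_ : _ <= (K%:R^-1 * expR gamma) ^+ N)) _.
- by rewrite mulr_ge0 // expR_ge0.
- by rewrite lerXn2r ?nnegrE // mulr_ge0 ?invr_ge0 ?expR_ge0 // ltW.
rewrite card_ffun !card_ord natrX exprMn -expRM_natr exprVn -[leLHS]mulrA mulVKf; last first.
  by rewrite expf_neq0 // gt_eqF.
rewrite -expRD ler_expR; lra.
Qed.

(** If the conclusion fails, each of the other dilates has an approximant y i in Q up
    to tau in measure.  Outside the exceptional set, the pattern of x is close to the
    column space of the matrix of the coefficients of the y i, off the set B of the
    far indices and of the indices i such that x is in M i: the measures of these
    points and of the exceptional set add up to less than 1. *)
Lemma many_far_indices (R : realType) (phi : R -> R) (eps : R) :
  riemann_integrable phi 0 1 ->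
  (forall c : R, (0 < circle_measure [set x | phi x <> c])%E) -> 0 < eps ->
  exists lambda tau b : R, exists K : nat,
  [/\ 1 < lambda, 0 < tau, 0 < b & (0 < K)%N] /\
  forall (N : nat) (k : 'I_N -> nat) (n : nat) (Q : set (R -> R)),
    (0 < N)%N -> lacunary lambda k -> n%:R <= N%:R * (1 - eps) ->
    subspace_dim_le L0 n Q -> b * N%:R <= #|far_indices phi tau K k Q|%:R.
Proof.
move=> phi_int phi_nc eps0.
have [K1 [kappa [K10 kappa0 hkappa]]] := gaussian_cells phi_int phi_nc.
have [gamma [h [beta [tau [[gamma0 h0 beta0 tau0] [[hg1 hg2 hb1 hb2] [ht1 ht2]]]]]]] :=
  constants_exist kappa0 eps0.
have [K0 few] := few_nonflat_cells phi_int tau0 tau0.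
(* A multiple of K1, as gaussian_cells requires, that is at least K0. *)
have [K KE] : exists K, K = (K1 * K0.+1)%N by eexists.
have Kpos : (0 < K)%N by rewrite KE muln_gt0 K10.
have K0K : (K0 <= K)%N by rewrite KE (leq_trans (leqnSn _)) // leq_pmull.
have {}few := few K Kpos K0K.
have Kpos' : 0 < K%:R :> R by rewrite ltr0n.
(* This ratio lambda satisfies 2 K / lambda <= gamma. *)
exists (2 + 2 * K%:R / gamma), tau, (beta / 2), K; split.
  split=> //; last by rewrite divr_gt0.
  have : 0 < 2 * K%:R / gamma by rewrite divr_gt0 // mulr_gt0.
  lra.
move=> N k n Q N0 klac le_n [QL0 [g QE]].
have lambda0 : 0 < 2 + 2 * K%:R / gamma by rewrite addr_gt0 // divr_gt0 // mulr_gt0.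
have le_lambda : 2 * K%:R / (2 + 2 * K%:R / gamma) <= gamma.
  by rewrite ler_pdivrMr // mulrDr [gamma * (_ / _)]mulrC divfK ?gt_eqF // lerDr mulr_ge0 // ltW.
have N0' : 0 < N%:R :> R by rewrite ltr0n.
rewrite leNgt; apply/negP => few_far.
have [Z ZE] : exists Z : {set 'I_N}, Z =i far_indices phi tau K k Q.
  by exists [set i in far_indices phi tau K k Q]%SET => i; rewrite finset.in_set.
rewrite -(eq_card ZE) in few_far.
have /choice[a ha] : forall i : 'I_N, exists a : 'I_n -> R, i \notin Z ->
    (lebesgue (far_set phi tau K (k i) (fun x => \sum_(l < n) a l * g l x)%R) <= tau%:E)%E.
  move=> i; have [iZ|] := boolP (i \in Z); first by exists (fun=> 0).
  rewrite ZE inE => /asboolPn/existsNP[y /not_implyP[]]; rewrite QE => -[a _ <-].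
  by move/negP; rewrite -ltNge => /ltW ?; exists a.
pose y i x := \sum_(l < n) a i l * g l x.
have Ly i : L0 (y i) by apply: QL0; rewrite QE; exists (a i).
have [k0 _] := klac.
have beta20 : 0 < beta / 2 by rewrite divr_gt0.
have [M [muX M_far M_flat]] := exceptional_set N0 Kpos (ltW tau0) k0 Ly beta20 few ha.
set X := [set x | _] in muX.
pose c (a : 'I_K) := phi (a%:R / K%:R).
pose A : 'M[R]_(N, n) := \matrix_(i, l) a i l.
pose E := [set s : {ffun 'I_N -> 'I_K} | `[< exists B : {set 'I_N},
        #|B|%:R <= beta * N%:R /\ near_off c A (2 * tau) B s >]]%SET.
have hc l : \sum_a expR (- (c a - l) ^+ 2) <= #|'I_K|%:R * expR (- kappa).
  by rewrite card_ord /c KE; exact: hkappa.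
have cardE : #|E|%:R <= expR (- 2 * gamma * N%:R) * #|{ffun 'I_N -> 'I_K}|%:R.
  apply: (card_near_off_union hc kappa0 eps0 hg1 hg2 h0 hb1 hb2 _ ht1 A le_n N0).
  by rewrite mulr_ge0 // ltW.
have muY : (lebesgue (`[0 : R, 1[%classic `\` X)%R <= (expR (- gamma * N%:R))%:E)%E.
  apply: (lebesgue_patterns Kpos lambda0 le_lambda N0 klac cardE) => x [x01 nX].
  split=> //; have /choice[s hs] : forall i, exists a : 'I_K, cell a ((k i)%:R * x).
    by move=> i; exact: cell_ex.
  exists [ffun i => s i]; last by move=> i; rewrite ffunE.
  rewrite inE; apply/asboolP.
  exists [set i | (i \in Z) || `[< M i x >]]%SET; split.
    apply: le_trans (_ : (#|Z| + #|[pred i | (i \notin Z) && `[< M i x >]]|)%:R <= _).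
      rewrite ler_nat -cardUI; apply: leq_trans (leq_addr _ _).
      apply: subset_leq_card; apply/fintype.subsetP => i; rewrite !inE.
      by case: (i \in Z).
    have bad_lt : #|[pred i | (i \notin Z) && `[< M i x >]]|%:R < beta / 2 * N%:R.
      rewrite ltNge; apply/negP => hX; apply: nX; apply: le_trans hX _.
      rewrite big_enum /= -sum1_card natr_sum big_mkcondr /=.
      by apply: ler_sum => i _; rewrite indicE; case: asboolP => // Mx; rewrite mem_set.
    rewrite natrD; move: few_far; lra.
  exists (\col_l g l x) => i; rewrite inE negb_or => /andP[_ /asboolPn nM].
  have -> : (A *m \col_l g l x) i 0 = y i x.
    by rewrite mxE; apply: eq_bigr => l _; rewrite !mxE.
  rewrite ffunE leNgt; apply/negP => hfar; apply: (M_far i x x01 nM).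
  split=> //; exists (s i); split; [exact: M_flat (hs i)|exact: hs|exact: ltW].
have : (lebesgue (`[0 : R, 1[%classic : set R)%R <= (4 * tau / beta)%R%:E + (expR (- gamma))%:E)%E.
  apply: le_trans (_ : (lebesgue (X `|` (`[0 : R, 1[%classic `\` X))%R <= _)%E).
    by apply: le_lebesgue => x x01; have [?|?] := pselect (X x); [left|right].
  apply: le_trans (outer_measureU2 (wlength (@idfun R))^*%mu _ _) _.
  apply: leeD.
    rewrite (_ : 4 * tau / beta = 2 * tau / (beta / 2)) //.
    by field; rewrite gt_eqF.
  apply: le_trans muY _; rewrite lee_fin ler_expR mulNr lerN2.
  by rewrite ler_peMr ?ler1n // ltW.
by rewrite lebesgue_itv // subr0 -EFinD lee_fin leNgt ht2.
Qed.

Lemma dist_to_ge (R : realType) (nrm : (R -> R) -> \bar R) f Q (t : \bar R) :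
  (forall y, Q y -> (t <= nrm (f \- y)%R)%E) -> (t <= dist_to nrm f Q)%E.
Proof. by move=> h; apply: le_ereal_inf_tmp => _ [y Qy <-]; exact: h. Qed.

Lemma avg_width_ge (R : realType) (X : set (R -> R)) (nrm : (R -> R) -> \bar R) n N
    (f : 'I_N -> R -> R) (b t : R) (P : set (R -> R) -> pred 'I_N) :
  (0 < N)%N -> 0 <= t -> (forall u, (0 <= nrm u)%E) ->
  (forall Q, subspace_dim_le X n Q -> b * N%:R <= #|P Q|%:R) ->
  (forall Q y i, subspace_dim_le X n Q -> i \in P Q -> Q y ->
     (t%:E <= nrm (f i \- y)%R)%E) ->
  ((b * t)%R%:E <= avg_width X nrm n f)%E.
Proof.
move=> N0 t0 nrm0 hP hf; apply: le_ereal_inf_tmp => _ [Q hQ <-].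
have N0' : 0 < N%:R :> R by rewrite ltr0n.
apply: le_trans (_ : ((N%:R^-1)%:E * (\sum_(i | i \in P Q) t%:E) <= _)%E).
  rewrite sumEFin -EFinM lee_fin sumr_const -[t *+ _]mulr_natl mulrA ler_wpM2r //.
  by rewrite mulrC ler_pdivlMr // hP.
apply: lee_wpmul2l; first by rewrite lee_fin invr_ge0 ltW.
rewrite big_mkcond /=; apply: lee_sum => i _; case: ifPn => [iP|_].
  by apply: dist_to_ge => y; exact: hf.
by apply: dist_to_ge => y _; exact: nrm0.
Qed.

Theorem mainTheorem11 (R : realType) (phi : R -> R)
    (phi_periodic : periodic phi 1)
    (phi_riemann : riemann_integrable phi 0 1)
    (phi_nonconst : forall c : R, (0 < circle_measure [set x | phi x <> c])%E) :
  (exists lambda c : R, 1 < lambda /\ 0 < c /\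
     forall (N : nat) (k : 'I_N -> nat), (0 < N)%N -> lacunary lambda k ->
     forall n : nat, n%:R <= c * N%:R ->
       (c%:E <= avg_width L0 L0norm n (dilates phi k))%E) /\
  (forall eps : R, 0 < eps ->
   exists lambda c : R, 1 < lambda /\ 0 < c /\
     forall (N : nat) (k : 'I_N -> nat), (0 < N)%N -> lacunary lambda k ->
     forall n : nat, n%:R <= N%:R * (1 - eps) ->
       (c%:E <= avg_width L1 L1norm n (dilates phi k))%E).
Proof.
have L0norm_ge0 (f : R -> R) : (0 <= L0norm f)%E.
  by apply: ereal_sup_ubound; exists 0 => //=; split=> //; exact: measure_ge0.
have L1norm_ge0 (f : R -> R) : (0 <= L1norm f)%E.
  by apply: integral_ge0 => x _; rewrite lee_fin.
split.
  have half0 : 0 < 2^-1 :> R by rewrite invr_gt0.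
  have [lambda [tau [b [K [[lambda1 tau0 b0 K0] h]]]]] :=
    many_far_indices phi_riemann phi_nonconst half0.
  pose c := Num.min 2^-1 (b * tau).
  have c0 : 0 < c by rewrite lt_min half0 mulr_gt0.
  have c_half : c <= 2^-1 by rewrite ge_min lexx.
  have c_btau : c <= b * tau by rewrite ge_min lexx orbT.
  exists lambda, c; split=> //; split=> // N k N0 klac n le_n.
  have {}le_n : n%:R <= N%:R * (1 - 2^-1) :> R.
    apply: le_trans le_n _; rewrite mulrC ler_wpM2l //; lra.
  apply: le_trans (_ : ((b * tau)%R%:E <= _)%E); first by rewrite lee_fin.
  apply: (avg_width_ge (P := far_indices phi tau K k)) => //; first exact: ltW.
    by move=> Q; exact: h klac le_n.
  move=> Q y i hQ /asboolP hi Qy.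
    exact: (L0norm_far phi_periodic K0 (ltW tau0) (hi y Qy)).
move=> eps eps0; have [lambda [tau [b [K [[lambda1 tau0 b0 K0] h]]]]] :=
  many_far_indices phi_riemann phi_nonconst eps0.
exists lambda, (b * (tau * tau)); split=> //; split; first by rewrite !mulr_gt0.
move=> N k N0 klac n le_n.
have L1L0 Q : subspace_dim_le L1 n Q -> subspace_dim_le L0 n Q.
  by case=> QL1 gQ; split=> // f /QL1[].
apply: (avg_width_ge (P := far_indices phi tau K k)) => //.
- by rewrite mulr_ge0 // ltW.
- by move=> Q /L1L0; exact: h klac le_n.
- move=> Q y i /L1L0[QL0 _] /asboolP hi Qy.
  apply: (L1norm_far phi_periodic K0 _ (ltW tau0) (QL0 _ Qy) (hi y Qy)).
  by case: klac.
Qed.
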